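(* Let $(\lambda_i)_{i\in\mathbb{N}}$ and $(\gamma_{ij})_{i,j\in\mathbb{N}}$ be as in the context, with $\lambda_i\ge\underline{\lambda}>0$ for all $i$ and $\sup_{j\in\mathbb{N}}\sum_{i=1}^\infty\gamma_{ij}<\infty$. Assume that the constants $\lambda_i$ are uniformly bounded from above. Let $\Theta:\ell^\infty\to\ell^\infty$ be given by $(\Theta x)_i=\sum_{j=1}^\infty\frac{\gamma_{ji}}{\lambda_j}x_j$. Then $r(\Theta)<1$ implies the following statements: (i) there exist a vector $\mu=(\mu_i)_{i\in\mathbb{N}}\in\operatorname{int}K$ and a constant $\lambda_\infty>0$ such that $$\frac{[\mu^{\top}(-\Lambda+\Gamma)]_i}{\mu_i}\le-\lambda_\infty\quad\text{for all }i\in\mathbb{N};$$ (ii) for every $\rho>0$, the vector $\mu$ and the constant $\lambda_\infty$ in statement (i) can be chosen in such a way that $$\lambda_\infty\ge(1-r(\Theta))\underline{\lambda}-\rho.$$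
   Context: For each $i\in\mathbb{N}=\{1,2,\dots\}$, $I_i\subset\mathbb{N}\setminus\{i\}$ is a finite set, $\lambda_i>0$, $\gamma_{ij}>0$ for $j\in I_i$, and $\gamma_{ij}:=0$ for $j\notin I_i$. $\Lambda:=\operatorname{diag}(\lambda_1,\lambda_2,\dots)$ and $\Gamma:=(\gamma_{ij})_{i,j\in\mathbb{N}}$ are infinite matrices; $[\mu^{\top}(-\Lambda+\Gamma)]_i=-\lambda_i\mu_i+\sum_{j=1}^\infty\mu_j\gamma_{ji}$. $\ell^\infty$ is the Banach space of bounded real sequences with the sup-norm, $K:=\{(x_i)\in\ell^\infty:x_i\ge0\ \forall i\}$, and $\operatorname{int}K=\{x\in\ell^\infty:\exists\,\underline{x}>0\text{ such that }x_i\ge\underline{x}\ \forall i\}$. $\Theta$ is the adjoint of the operator $\Psi=\Lambda^{-1}\Gamma:\ell^1\to\ell^1$. $r(\cdot)$ denotes the spectral radius (of the complexification). *)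

(* Defs.v *)
From HB Require Import structures.
From mathcomp Require Import all_boot all_order all_algebra.
From mathcomp Require Import all_classical all_reals all_analysis.
From mathcomp Require Import complex lra.

Set Implicit Arguments.
Unset Strict Implicit.
Unset Printing Implicit Defensive.
Import Order.TTheory GRing.Theory Num.Theory.
Import numFieldNormedType.Exports.
Local Open Scope classical_set_scope.
Local Open Scope ring_scope.

(* Sequences are indexed by nat: the index i = 1, 2, ... of the mathematics is
   shifted to i = 0, 1, .... *)

Section bounded_sequences.
Variable R : realType.

Definition bounded_seq : {pred nat -> R} := fun u => `[< bounded_fun u >].

Lemma bounded_seqP (u : nat -> R) :
  reflect (exists M, forall i, `|u i| <= M) (u \in bounded_seq).
Proof.
have FF : ProperFilter (globally [set: nat]) by apply: globally_properfilter 0%N _.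
apply: (iffP (asboolP _)) => [ub|[M uM]].
  by have /ex_bound[M uM] := ub; exists M => i; exact: uM.
by apply/ex_bound; exists M => i _; exact: uM.
Qed.

Lemma bounded_seq_submod : submod_closed bounded_seq.
Proof.
split => [|a u v /bounded_seqP[M uM] /bounded_seqP[N vN]].
  by apply/bounded_seqP; exists 0 => i; rewrite normr0.
apply/bounded_seqP; exists (`|a| * M + N) => i.
rewrite (le_trans (ler_normD _ _))// lerD// normrM.
by rewrite ler_wpM2l.
Qed.

HB.instance Definition _ :=
  GRing.isSubmodClosed.Build R (nat -> R) bounded_seq bounded_seq_submod.

Record ellinfty := Ellinfty {
  seq_of_ellinfty :> nat -> R;
  ellinftyP : seq_of_ellinfty \in bounded_seq }.

HB.instance Definition _ := [isSub for seq_of_ellinfty].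
HB.instance Definition _ := [Choice of ellinfty by <:].
HB.instance Definition _ := [SubChoice_isSubLmodule of ellinfty by <:].

Definition ellinfty_norm (x : ellinfty) : R := sup (range (fun i => `|x i|)).

Lemma ellinfty_has_sup (x : ellinfty) : has_sup (range (fun i => `|x i|)).
Proof.
have /bounded_seqP[M xM] := ellinftyP x.
by split; [exists `|x 0%N|, 0%N|exists M => _ [i _ <-]].
Qed.

Lemma ellinfty_norm_ge (x : ellinfty) i : `|x i| <= ellinfty_norm x.
Proof.
have [_ xM] := ellinfty_has_sup x.
by apply: ub_le_sup => //; exists i.
Qed.

Lemma ellinfty_norm_le (x : ellinfty) M :
  (forall i, `|x i| <= M) -> ellinfty_norm x <= M.
Proof.
move=> xM; apply: ge_sup; first by have [] := ellinfty_has_sup x.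
by move=> _ [i _ <-].
Qed.

Lemma ellinfty_normD (x y : ellinfty) :
  ellinfty_norm (x + y) <= ellinfty_norm x + ellinfty_norm y.
Proof.
apply: ellinfty_norm_le => i; rewrite (le_trans (ler_normD _ _))//.
by rewrite lerD// ellinfty_norm_ge.
Qed.

Lemma ellinfty_normZ (a : R) (x : ellinfty) :
  ellinfty_norm (a *: x) = `|a| * ellinfty_norm x.
Proof.
apply/eqP; rewrite eq_le; apply/andP; split.
  apply: ellinfty_norm_le => i.
  by rewrite normrM ler_wpM2l// ellinfty_norm_ge.
have [->|a0] := eqVneq a 0.
  rewrite normr0 mul0r.
  by apply: le_trans (ellinfty_norm_ge _ 0%N); exact: normr_ge0.
rewrite -ler_pdivlMl ?normr_gt0//; apply: ellinfty_norm_le => i.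
rewrite ler_pdivlMl ?normr_gt0// -normrM.
exact: (ellinfty_norm_ge (a *: x)).
Qed.

Lemma ellinfty_norm_eq0 (x : ellinfty) : ellinfty_norm x = 0 -> x = 0.
Proof.
move=> x0; apply/val_inj/funext => i /=; apply/normr0_eq0/eqP.
by rewrite eq_le normr_ge0 andbT -[leRHS]x0 ellinfty_norm_ge.
Qed.

HB.instance Definition _ := Lmodule_isNormed.Build R ellinfty
  ellinfty_normD ellinfty_normZ ellinfty_norm_eq0.

Lemma ellinfty_complete (F : set_system ellinfty) :
  ProperFilter F -> cauchy F -> cvg F.
Proof.
move=> FF /cauchyP Fc.
have coord_cvg i : cvg ((fun x : ellinfty => x i) @ F).
  apply: R_complete; apply/cauchyP => e e0.
  have [x Fx] := Fc _ e0; exists (x i).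
  have : F ((fun y : ellinfty => y i) @^-1` ball (x i) e); last by [].
  apply: filterS Fx => y; rewrite -!ball_normE/= => xy.
  exact: le_lt_trans (ellinfty_norm_ge (x - y) i) xy.
pose l i : R := lim ((fun x : ellinfty => x i) @ F).
have ball_l (x : ellinfty) e i : F (ball x e) -> `|x i - l i| <= e.
  move=> Fx; apply/ler_addgt0Pr => d d0.
  have : \forall y \near F, `|l i - (y : ellinfty) i| < d.
    by have /cvgrPdist_lt := coord_cvg i; exact.
  move=> /(filterI Fx) /filter_ex[y [xy ly]].
  move: xy; rewrite -ball_normE/= => xy.
  rewrite -(subrKA (y i)) (le_trans (ler_normD _ _))// lerD//.
    by rewrite (le_trans (ellinfty_norm_ge (x - y) i))// ltW.
  by rewrite distrC ltW.
have lP : l \in bounded_seq.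
  have [x Fx] := Fc _ (@ltr01 R); apply/bounded_seqP; exists (`|x| + 1) => i.
  rewrite -(subrK (x i) (l i)) (le_trans (ler_normD _ _))// addrC lerD//.
    exact: ellinfty_norm_ge.
  by rewrite distrC ball_l.
apply/cvg_ex; exists (Ellinfty lP); apply/cvgrPdist_le => e e0.
have e20 : 0 < e / 2 by rewrite divr_gt0.
have [x Fx] := Fc _ e20.
apply: filterS (Fx) => y; rewrite -ball_normE/= => xy.
rewrite (splitr e) -(subrKA x) (le_trans (ler_normD _ _))// lerD//; last exact: ltW.
by apply: ellinfty_norm_le => i; rewrite distrC; exact: ball_l.
Qed.

HB.instance Definition _ := Uniform_isComplete.Build ellinfty ellinfty_complete.

Definition coneK : set ellinfty := [set x | forall i, 0 <= x i].

Lemma interior_coneK :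
  coneK° = [set x : ellinfty | exists2 a, 0 < a & forall i, a <= x i].
Proof.
apply/seteqP; split => x.
  move=> /nbhs_ballP[e /= e0 xK]; exists (e / 2); first by rewrite divr_gt0.
  have cP : (fun=> e / 2 : R) \in bounded_seq.
    by apply/bounded_seqP; exists `|e / 2|.
  move=> i; rewrite -subr_ge0; apply: (xK (x - Ellinfty cP)).
  rewrite -ball_normE/= opprB addrC subrK.
  apply: (@le_lt_trans _ _ (e / 2)); last by rewrite ltr_pdivrMr// ltr_pMr// ltr1n.
  by apply: ellinfty_norm_le => j /=; rewrite gtr0_norm ?divr_gt0.
move=> [a a0 ax]; apply/nbhs_ballP; exists a => //= y.
rewrite -ball_normE/= => xy i.
have := le_lt_trans (ellinfty_norm_ge (x - y) i) xy.
move=> /(le_lt_trans (ler_norm _)) xya.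
by have : x i - y i < a := xya; have := ax i; lra.
Qed.

End bounded_sequences.

Section complexification.
Variables (R : realType) (V : normedModType R).

(* (x, y) stands for x + i y.  All the usual norms of the complexification
   induce the product topology. *)
Definition complexification : Type := (V * V)%type.

HB.instance Definition _ := GRing.Zmodule.on complexification.
HB.instance Definition _ := Topological.copy complexification (V * V)%type.

Definition cplx_scale (z : R[i]) (u : complexification) : complexification :=
  (complex.Re z *: u.1 - complex.Im z *: u.2,
   complex.Re z *: u.2 + complex.Im z *: u.1).

Lemma cplx_scaleA z w u : cplx_scale z (cplx_scale w u) = cplx_scale (z * w) u.
Proof.
case: z w u => [a b] [c d] [x y]; rewrite /cplx_scale/=; congr pair.
  rewrite !(scalerBr, scalerDr, scalerA, scalerBl, scalerDl) !opprD !addrA.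
  by rewrite [LHS]addrAC; congr (_ - _); rewrite addrAC.
rewrite !(scalerBr, scalerDr, scalerA, scalerBl, scalerDl) !addrA.
by rewrite [LHS]addrAC; congr (_ + _); rewrite addrAC.
Qed.

Lemma cplx_scale1 : left_id 1 cplx_scale.
Proof. by case=> x y; rewrite /cplx_scale/= !scale1r !scale0r subr0 addr0. Qed.

Lemma cplx_scaleDr : right_distributive cplx_scale +%R.
Proof.
move=> [a b] [x y] [x' y']; rewrite /cplx_scale/=; congr pair.
  by rewrite !scalerDr opprD addrACA.
by rewrite !scalerDr addrACA.
Qed.

Lemma cplx_scaleDl u : {morph cplx_scale^~ u : z w / z + w}.
Proof.
move: u => [x y] [a b] [c d]; rewrite /cplx_scale/=; congr pair.
  by rewrite !scalerDl opprD addrACA.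
by rewrite !scalerDl addrACA.
Qed.

HB.instance Definition _ := GRing.Zmodule_isLmodule.Build R[i] complexification
  cplx_scaleA cplx_scale1 cplx_scaleDr cplx_scaleDl.

Definition complexify (T : V -> V) : complexification -> complexification :=
  fun u => (T u.1, T u.2).

End complexification.

Section spectrum.
Variables (R : realType).

Definition spectrum (U : preTopologicalLmodType R[i]) (T : U -> U) : set R[i] :=
  ~` [set z | exists S : {linear U -> U},
    [/\ continuous S, cancel (fun u => z *: u - T u) S
      & cancel S (fun u => z *: u - T u)]].

(* sup is total on sets of reals; when T is bounded, linear and acts on a
   nontrivial Banach space, the spectrum is nonempty and bounded. *)
Definition spectral_radius (V : normedModType R) (T : V -> V) : R :=
  sup [set ComplexField.Normc.normc z | z in spectrum (complexify T)].

End spectrum.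

Section network.
Variable R : realType.
Implicit Types (lambda : nat -> R) (gamma : nat -> nat -> R).

(* The i-th entry of the row vector mu^T (- Lambda + Gamma). *)
Definition row_mulLG lambda gamma (mu : ellinfty R) (i : nat) : R :=
  - lambda i * mu i + limn (series (fun j => mu j * gamma j i)).

(* The series defining Theta converge and give bounded sequences. *)
Lemma gain_operator_exists lambda gamma (lo : R) :
  0 < lo -> (forall i, lo <= lambda i) -> (forall i j, 0 <= gamma i j) ->
  (ereal_sup (range (fun j => \sum_(i <oo) (gamma i j)%:E)) < +oo)%E ->
  exists Theta : ellinfty R -> ellinfty R, forall (x : ellinfty R) i,
    series (fun j => gamma j i / lambda j * x j) @ \oo --> Theta x i.
Proof.
move=> lo0 lo_lambda gamma0 supfin.
pose S := ereal_sup (range (fun j => \sum_(i <oo) (gamma i j)%:E)%E).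
have sum_le i n : ((\sum_(0 <= j < n) gamma j i)%:E <= S)%E.
  rewrite -sumEFin; apply: le_trans (ereal_sup_ubound _); last by exists i.
  by apply: nneseries_lim_ge => k _ _; rewrite lee_fin.
have S_fin : S \is a fin_num.
  by rewrite ge0_fin_numE// (le_trans _ (sum_le 0%N 0%N))// big_geq.
pose C := fine S.
have CP i n : \sum_(0 <= j < n) gamma j i <= C.
  by rewrite -lee_fin fineK.
pose u (x : ellinfty R) i j := gamma j i / lambda j * x j.
have lambda0 j : 0 < lambda j by exact: lt_le_trans (lo_lambda j).
have u_bound x i n : [normed series (u x i)] n <= C / lo * `|x|.
  rewrite (@le_trans _ _ (\sum_(0 <= j < n) gamma j i * (lo^-1 * `|x|)))//.
    apply: ler_sum => j _; rewrite /= /u !normrM ger0_norm// -mulrA ler_wpM2l//.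
    rewrite ler_pM//; last exact: ellinfty_norm_ge.
    by rewrite gtr0_norm ?invr_gt0// lef_pV2 ?posrE.
  by rewrite -mulr_suml -mulrA ler_wpM2r// mulr_ge0// invr_ge0 ltW.
have u_ncvg x i : cvgn [normed series (u x i)].
  apply: nondecreasing_is_cvgn; first by apply: nondecreasing_series => k _ _ /=.
  by exists (C / lo * `|x|) => _ [n _ <-].
have Tb x : (fun i => limn (series (u x i))) \in @bounded_seq R.
  apply/bounded_seqP; exists (C / lo * `|x|) => i.
  apply: le_trans (lim_series_norm (u_ncvg x i)) _.
  by apply: limr_le => //; apply: nearW => n; exact: u_bound.
exists (fun x => Ellinfty (Tb x)) => x i.
exact: normed_cvg (u_ncvg x i).
Qed.

End network.

(* Main.v *)
Require Import Defs.
From HB Require Import structures.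
From mathcomp Require Import all_boot all_order all_algebra.
From mathcomp Require Import all_classical all_reals all_analysis.
From mathcomp Require Import complex lra.
Import Order.TTheory GRing.Theory Num.Theory.
Import numFieldNormedType.Exports.
Local Open Scope classical_set_scope.
Local Open Scope ring_scope.

(** For [s] strictly between [r(Theta)] and [1], let [x] solve
    [s x - Theta x = 1], where [1] is the constant sequence.  If [x >= 0], then
    positivity of [Theta] gives [s x >= 1], so [x] is bounded below by [1 / s],
    and [mu_i = x_i / lambda_i] lies in the interior of the cone because
    [lambda] is bounded.  The [i]-th entry of [mu^T (- Lambda + Gamma)] is
    [- x_i + (Theta x)_i <= - (1 - s) x_i], which is at most
    [- (1 - s) lambda_lo mu_i].  Letting [s] approach [r(Theta)] makes the decay
    rate [(1 - s) lambda_lo] as close to [(1 - r(Theta)) lambda_lo] as desired.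

    The substance is therefore that [x] exists and is nonnegative for every
    [s > r(Theta)] ([positive_resolvent]).  The usual argument expands the
    resolvent as a Neumann series on all of [s > r(Theta)], which relies on
    Gelfand's formula and hence on complex analysis.  The proof below replaces
    it by the intermediate value theorem.  Write [x_t] for the solution at
    [t > r(Theta)] and [m(t)] for the infimum of its entries.  Then [m] is
    continuous ([resolvent_continuous], [coord_inf_lipschitz]), and [m(t) >= 0]
    for large [t] ([coord_inf_resolvent_ge0]).  Moreover [m] never vanishes:
    [m(t) = 0] would mean [x_t >= 0], whence [x_t >= 1 / t > 0]
    ([positive_resolvent_ge]).  So [m] stays positive down to [r(Theta)].

    Solvability for [t > r(Theta)] needs some care, since the spectral radius is
    a supremum of moduli, and a supremum bounds a set from above only if the set
    is bounded.  Boundedness of the spectrum ([spectrum_normc_le]) comes from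
    the contraction principle applied to [u = (w + T u) / z]; the fixed point
    exists because a product of two complete spaces is complete. *)

(** * Completeness of products and contractions *)

(** This joins the uniform structure of a product with its distinguished point;
    completeness can be declared only on a type that carries both. *)
HB.instance Definition _ (U V : puniformType) :=
  Uniform.copy (U * V)%type (U * V)%type.

Lemma prod_complete (R : realType) (U V : completeNormedModType R)
    (F : set_system (U * V)%type) : ProperFilter F -> cauchy F -> cvg F.
Proof.
move=> FF /cauchyP Fc.
have cvg1 : cvg (fst @ F).
  apply/cauchy_cvgP/cauchyP => e e0; have [x Fx] := Fc _ e0; exists x.1.
  have : F ((fun y => y.1) @^-1` ball x.1 e); last by [].
  by apply: filterS Fx => y xy; exact: xy.1.
have cvg2 : cvg (snd @ F).
  apply/cauchy_cvgP/cauchyP => e e0; have [x Fx] := Fc _ e0; exists x.2.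
  have : F ((fun y => y.2) @^-1` ball x.2 e); last by [].
  by apply: filterS Fx => y xy; exact: xy.2.
apply/cvg_ex; exists (lim (fst @ F), lim (snd @ F)).
move=> A FA; have /= FA' : F ((fun x => (x.1, x.2)) @^-1` A).
  by have := cvg_pair cvg1 cvg2; apply.
by apply: filterS FA' => -[x y].
Qed.

HB.instance Definition _ (R : realType) (U V : completeNormedModType R) :=
  Uniform_isComplete.Build (U * V)%type (@prod_complete R U V).

Lemma contraction_fixed_point (R : realType) (X : completeNormedModType R)
    (f : X -> X) (q : R) : 0 <= q -> q < 1 ->
  (forall x y, `|f x - f y| <= q * `|x - y|) -> exists p, p = f p.
Proof.
move=> q0 q1 fq.
have ctr : @is_contraction R X X setT setT [fun of totalfun f].
  by exists (NngNum q0); split => //= -[x y] _; exact: fq.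
have [||p _ pE] := banach_fixed_point ctr; [exact: closedT|by exists 0|].
by exists p.
Qed.

Lemma lipschitz_continuous (R : realType) (X Y : normedModType R) (f : X -> Y)
    (M : R) : (forall x y, `|f x - f y| <= M * `|x - y|) -> continuous f.
Proof.
move=> fM x; apply/(@cvgrPdist_lt _ _ _ (nbhs x)) => e e0; near=> y.
have M0 : 0 < `|M| + 1 by rewrite ltr_wpDl.
apply: (@le_lt_trans _ _ ((`|M| + 1) * `|x - y|)).
  by rewrite (le_trans (fM _ _))// ler_wpM2r// (le_trans (ler_norm _))// lerDl.
rewrite -ltr_pdivlMl//; near: y; apply: cvgr_dist_lt => //.
by rewrite mulr_gt0// invr_gt0.
Unshelve. all: by end_near. Qed.

(** * The norm of a complexification and its scalars *)

Lemma Re_le_normc (R : rcfType) (z : R[i]) :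
  `|complex.Re z| <= ComplexField.Normc.normc z.
Proof.
by case: z => a b /=; rewrite -sqrtr_sqr ler_wsqrtr// lerDl sqr_ge0.
Qed.

Lemma Im_le_normc (R : rcfType) (z : R[i]) :
  `|complex.Im z| <= ComplexField.Normc.normc z.
Proof.
by case: z => a b /=; rewrite -sqrtr_sqr ler_wsqrtr// lerDr sqr_ge0.
Qed.

(** The max norm of [V * V] is not homogeneous for complex scalars, but it is so
    up to a factor [2], which is enough to bound the spectrum. *)
Lemma norm_cplx_scale (R : realType) (V : normedModType R) (z : R[i])
    (u : V * V) :
  `|cplx_scale z u : V * V| <= 2 * ComplexField.Normc.normc z * `|u|.
Proof.
have u1 : `|u.1| <= `|u| by rewrite [leRHS]prod_normE le_max lexx.
have u2 : `|u.2| <= `|u| by rewrite [leRHS]prod_normE le_max lexx orbT.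
have := Re_le_normc _ z; have := Im_le_normc _ z => hI hR.
rewrite -mulrA mulr_natl mulr2n prod_normE ge_max /=; apply/andP; split.
  by rewrite (le_trans (ler_normB _ _))// !normrZ lerD// ler_pM.
by rewrite (le_trans (ler_normD _ _))// !normrZ lerD// ler_pM.
Qed.

Lemma complexify_linear (R : realType) (V : normedModType R)
    (T : {linear V -> V}) :
  linear (complexify T : complexification V -> complexification V).
Proof.
move=> a u v; apply: injective_projections => /=.
  by rewrite linearD linearB !linearZ.
by rewrite !linearD !linearZ.
Qed.

HB.instance Definition _ (R : realType) (V : normedModType R)
    (T : {linear V -> V}) :=
  GRing.isLinear.Build R[i] (complexification V) (complexification V) _
    (complexify T) (@complexify_linear R V T).

(** * Boundedness of the spectrum and real resolvents *)

(** If [normc z > 2 C], the equation [z u - T u = w] reads [u = (w + T u) / z],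
    a fixed point problem for a contraction of [V * V]; its solution operator is
    the continuous linear inverse that keeps [z] out of the spectrum.  The
    factor [2], inherited from [norm_cplx_scale], is not optimal. *)
Lemma spectrum_normc_le (R : realType) (V : completeNormedModType R)
    (T : {linear V -> V}) (C : R) (z : R[i]) :
  0 <= C -> (forall x, `|T x| <= C * `|x|) ->
  spectrum (complexify T) z -> ComplexField.Normc.normc z <= 2 * C.
Proof.
set normc := @ComplexField.Normc.normc R.
move=> C0 TC; rewrite leNgt; apply: contra_notN => Cz.
have nz0 : 0 < normc z by apply: le_lt_trans Cz; rewrite mulr_ge0.
have z0 : z != 0.
  by apply: contraTneq nz0 => ->; rewrite /normc ComplexField.Normc.normc0 ltxx.
pose q := 2 * normc z^-1 * C.
have nV0 : 0 <= normc z^-1 by rewrite /normc ComplexField.Normc.normcV invr_ge0 ltW.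
have q0 : 0 <= q by rewrite !mulr_ge0.
have q1 : q < 1.
  by rewrite /q /normc ComplexField.Normc.normcV mulrAC ltr_pdivrMr// mul1r.
pose TT := complexify T : V * V -> V * V.
have TTB u v : TT (u - v) = TT u - TT v.
  by rewrite /TT/complexify !linearB.
have TTq u : `|cplx_scale z^-1 (TT u) : V * V| <= q * `|u|.
  rewrite (le_trans (norm_cplx_scale _ _ _ _))// /q -!mulrA.
  rewrite ler_wpM2l// ler_wpM2l//.
  rewrite [leLHS]prod_normE ge_max /=; apply/andP; split; apply: le_trans (TC _) _;
    by rewrite ler_wpM2l// [leRHS]prod_normE le_max lexx ?orbT.
pose F (w u : complexification V) : complexification V :=
  z^-1 *: (w + complexify T u).
have Fsol w : exists u, u = F w u.
  apply: (@contraction_fixed_point R (V * V)%type (F w) q) => // u v.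
  apply: le_trans (TTq (u - v)); rewrite TTB.
  have -> : F w u - F w v = cplx_scale z^-1 (TT u - TT v)
      :> complexification V.
    by rewrite -scalerBr opprD addrACA subrr add0r.
  by [].
have FE w u : (u = F w u) <-> (z *: u - complexify T u = w).
  split=> [uF|<-].
    by rewrite [in z *: u]uF scalerA divff// scale1r addrK.
  by rewrite /F subrK scalerA mulVf// scale1r.
have inj u : u = F 0 u -> u = 0.
  rewrite /F add0r => uE; apply/eqP; rewrite -[_ == _]/((u : V * V) == 0).
  rewrite -normr_eq0 eq_le normr_ge0 andbT.
  have : `|u : V * V| <= q * `|u : V * V| by rewrite {1}uE; exact: TTq.
  by move: (`|u : V * V|) => n; nra.
have solU u v : z *: u - complexify T u = z *: v - complexify T v -> u = v.
  move=> uv; apply/eqP; rewrite -subr_eq0; apply/eqP/inj/FE.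
  by rewrite [complexify T _]linearB scalerBr opprD addrACA -opprD uv subrr.
have [S SE] := choice Fsol.
have SE' w : z *: S w - complexify T (S w) = w by apply/FE.
have Slin : linear S.
  move=> a u v; apply: solU; rewrite SE' [complexify T _]linearP.
  by rewrite scalerDr scalerA mulrC -scalerA opprD addrACA -scalerBr !SE'.
pose Sl : {linear complexification V -> complexification V} :=
  HB.pack S (GRing.isLinear.Build _ _ _ _ _ Slin).
pose M := 2 * normc z^-1 / (1 - q).
have SM w : `|S w : V * V| <= M * `|w : V * V|.
  rewrite /M mulrAC ler_pdivlMr ?subr_gt0// mulrBr mulr1 lerBlDr [_ * q]mulrC.
  rewrite {1}SE /F scalerDr (le_trans (ler_normD (_ : V * V) _))// lerD//.
    exact: norm_cplx_scale.
  exact: TTq.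
exists Sl; split.
- apply: (@lipschitz_continuous R (V * V)%type (V * V)%type _ M) => u v.
  by have := SM (u - v); rewrite -[S]/(Sl : _ -> _) linearB.
- by move=> u; apply: solU; rewrite SE'.
- exact: SE'.
Qed.

(** The complex inverse [S] at the real point [s] restricts to an inverse on [V],
    namely the first component of [S (w, 0)]; its continuity becomes the bound
    by [M]. *)
Lemma resolvent_of_gt_spectral_radius (R : realType)
    (V : completeNormedModType R) (T : {linear V -> V}) (C s : R) :
  0 <= C -> (forall x, `|T x| <= C * `|x|) -> spectral_radius T < s ->
  (forall w, exists x, s *: x - T x = w) /\
  (exists M, 0 <= M /\ forall x, `|x| <= M * `|s *: x - T x|).
Proof.
move=> C0 TC rs; have : ~ spectrum (complexify T) s%:C%C.
  move=> spec; move: rs; rewrite ltNge => /negP; apply.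
  apply: (@le_trans _ _ (ComplexField.Normc.normc s%:C%C)).
    by rewrite (le_trans (ler_norm _))// (Re_le_normc _ s%:C%C).
  apply: ub_le_sup; last by exists s%:C%C.
  by exists (2 * C) => _ [z zT <-]; exact: spectrum_normc_le TC zT.
move=> /contrapT[S [Sc SK KS]].
have scaleE (a : R) (u : complexification V) :
    a%:C%C *: u = (a *: u.1, a *: u.2).
  by apply: injective_projections; rewrite /= scale0r ?subr0 ?addr0.
pose j (w : V) : complexification V := (w, 0).
have jc : continuous (j : V -> (V * V)%type).
  by move=> w; apply: cvg_pair; [exact: cvg_id|exact: cvg_cst].
pose Q w : V := (S (j w)).1.
have Qlin : linear Q.
  move=> a u v; rewrite /Q.
  have -> : j (a *: u + v) = a%:C%C *: j u + j v.
    by rewrite scaleE; apply: injective_projections; rewrite /= ?scaler0 ?addr0.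
  by rewrite linearP scaleE.
pose Ql : {linear V -> V} := HB.pack Q (GRing.isLinear.Build _ _ _ _ _ Qlin).
have Qc : continuous Ql.
  move=> w; apply: (@cvg_comp _ _ _ (S \o j) fst _ (nbhs (S (j w)))).
    by apply: continuous_comp; [exact: jc|exact: Sc].
  exact: cvg_fst.
split=> [w|].
  by exists (Q w); have := KS (j w); rewrite scaleE => /(congr1 fst).
have /linear_boundedP [M [Mr HM]] := continuous_linear_bounded 0 (Qc 0).
exists (`|M| + 1); split; first by rewrite addr_ge0.
move=> x; have jx : j (s *: x - T x) = s%:C%C *: j x - complexify T (j x).
  rewrite scaleE; apply: injective_projections; rewrite //=.
  by rewrite scaler0 linear0 subr0.
have {1}-> : x = Q (s *: x - T x) by rewrite /Q jx SK.
by apply: HM; rewrite (le_lt_trans (ler_norm _))// ltrDl.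
Qed.

(** The first resolvent identity: with [x_t = X t], the operator [t - T] maps
    [x_t - x_u] to [(u - t) x_u], so [x_t - x_u] has norm at most
    [M |t - u| |x_u|], and [|x_u|] is at most [2 |x_t|] once
    [M |t - u| <= 1 / 2]. *)
Lemma resolvent_continuous (R : realType) (V : normedModType R)
    (T : {linear V -> V}) (r : R) (w : V) (X : R -> V) (t M : R) :
  (forall u, r < u -> u *: X u - T (X u) = w) -> r < t ->
  0 <= M -> (forall x, `|x| <= M * `|t *: x - T x|) -> {for t, continuous X}.
Proof.
move=> XE rt M0 HM.
have X_lip : \forall u \near t, `|X t - X u| <= 2 * M * `|X t| * `|t - u|.
  near=> u.
  have ru : r < u by near: u; exact: lt_nbhsr.
  have Mu : M * `|t - u| <= 2^-1.
    have : `|t - u| < (2 * (M + 1))^-1.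
      near: u; apply: (@cvgr_dist_lt _ _ _ (nbhs t)) => //.
      by rewrite invr_gt0 mulr_gt0// ltr_wpDl.
    have M1 : 0 < M + 1 by rewrite ltr_wpDl.
    rewrite -[ltRHS]mul1r ltr_pdivlMr ?mulr_gt0//.
    have := normr_ge0 (t - u); lra.
  have := HM (X t - X u).
  have -> : t *: (X t - X u) - T (X t - X u) = (u - t) *: X u.
    rewrite [T _]linearB scalerBr opprD addrACA XE// -[w](XE _ ru) opprK addrACA.
    by rewrite addNr addr0 scalerBl.
  rewrite normrZ [`|u - t|]distrC mulrA => d1.
  have d2 : `|X u| <= `|X t| + `|X t - X u|.
    by rewrite -{1}(subKr (X t) (X u)) ler_normB.
  have p0 : 0 <= M * `|t - u| by rewrite mulr_ge0.
  rewrite [leRHS]mulrAC -[2 * M * _]mulrA.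
  have := normr_ge0 (X t - X u); nra.
have K0 : 0 <= 2 * M * `|X t| by rewrite !mulr_ge0.
move: (2 * M * `|X t|) K0 X_lip => K K0 X_lip.
apply/(@cvgrPdist_lt _ _ _ (nbhs t)) => e e0; near=> u.
apply: (@le_lt_trans _ _ (K * `|t - u|)); first by near: u.
apply: (@le_lt_trans _ _ ((K + 1) * `|t - u|)).
  by rewrite ler_wpM2r// lerDl.
rewrite -ltr_pdivlMl ?ltr_wpDl//; near: u.
apply: (@cvgr_dist_lt _ _ _ (nbhs t)) => //.
by rewrite mulr_gt0// invr_gt0 ltr_wpDl.
Unshelve. all: by end_near. Qed.

(** * Positive operators on bounded sequences *)

Section coordinate_infimum.
Context {R : realType}.
Implicit Types x y : ellinfty R.

Definition coord_inf x : R := inf (range x).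

Lemma coord_inf_le x i : coord_inf x <= x i.
Proof.
apply: ge_inf; last by exists i.
exists (- `|x|) => _ [j _ <-].
by rewrite lerNl (le_trans _ (ellinfty_norm_ge x j))// -normrN ler_norm.
Qed.

Lemma le_coord_inf x a : (forall i, a <= x i) -> a <= coord_inf x.
Proof. by move=> ax; apply: lb_le_inf => [|_ [i _ <-]//]; exists (x 0%N), 0%N. Qed.

Lemma coord_inf_lipschitz x y : `|coord_inf x - coord_inf y| <= `|x - y|.
Proof.
have H u v : coord_inf u - `|u - v| <= coord_inf v.
  apply: le_coord_inf => i; have := coord_inf_le u i.
  have : u i - v i <= `|u - v|.
    by rewrite (le_trans (ler_norm _))// (ellinfty_norm_ge (u - v)).
  lra.
by rewrite ler_distl; have := H x y; have := H y x; rewrite distrC; lra.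
Qed.

Lemma bounded_seq_cst (a : R) : (fun=> a) \in @bounded_seq R.
Proof. by apply/bounded_seqP; exists `|a|. Qed.

Definition ellinfty_one : ellinfty R := Ellinfty (bounded_seq_cst 1).

End coordinate_infimum.

Section positive_operator.
Context {R : realType} (T : {linear ellinfty R -> ellinfty R}).
Hypothesis T_pos : forall x, coneK x -> coneK (T x).
Local Notation "\1" := (@ellinfty_one R).
Implicit Types x y : ellinfty R.

Lemma positive_monotone x y : (forall i, x i <= y i) -> forall i, T x i <= T y i.
Proof.
move=> xy i; rewrite -subr_ge0; have := T_pos (y - x); rewrite linearB; apply.
by move=> j; rewrite subr_ge0; exact: xy.
Qed.

(** Apply monotonicity to [- |x| <= x <= |x|], read as inequalities with
    constant sequences. *)
Lemma positive_bounded x : `|T x| <= `|T \1| * `|x|.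
Proof.
apply: ellinfty_norm_le => i.
have xle j : `|x j| <= `|x| := ellinfty_norm_ge x j.
have T1 : T \1 i <= `|T \1|.
  by rewrite (le_trans (ler_norm _))// ellinfty_norm_ge.
have hi : T x i <= T (`|x| *: \1) i.
  apply: positive_monotone => j; have := xle j; rewrite ler_norml => /andP[_].
  by rewrite -[in X in X -> _](mulr1 `|x|).
have lo : T (- `|x| *: \1) i <= T x i.
  apply: positive_monotone => j; have := xle j; rewrite ler_norml => /andP[+ _].
  by rewrite -[in X in X -> _](mulr1 (- `|x|)).
move: hi lo; rewrite !linearZ => hi lo.
have {}hi : T x i <= `|x| * T \1 i := hi.
have {}lo : - `|x| * T \1 i <= T x i := lo.
have := normr_ge0 x; rewrite ler_norml; nra.
Qed.

(** Since [T x >= 0], the equation gives [t x >= 1] entrywise: nonnegativity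
    self-improves to a uniform lower bound, so [coord_inf x] cannot be [0]. *)
Lemma positive_resolvent_ge t x : t *: x - T x = \1 -> coneK x ->
  0 < t /\ forall i, t^-1 <= x i.
Proof.
move=> tx x0.
have txi i : 1 <= t * x i.
  have : t * x i - T x i = 1 := congr1 (fun u : ellinfty R => u i) tx.
  have := T_pos _ x0 i; lra.
have t0 : 0 < t by have := txi 0%N; have := x0 0%N; nra.
by split=> // i; rewrite -[_^-1]mulr1 ler_pdivrMl.
Qed.

(** A negative infimum [m] would give [t x >= T x >= m |T 1|], hence
    [t m >= m |T 1|] and [t <= |T 1|]. *)
Lemma coord_inf_resolvent_ge0 t x :
  `|T \1| < t -> t *: x - T x = \1 -> 0 <= coord_inf x.
Proof.
move=> Tt tx; rewrite leNgt; apply/negP => m0.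
have t0 : 0 < t by rewrite (le_lt_trans _ Tt).
have : coord_inf x * `|T \1| / t <= coord_inf x.
  apply: le_coord_inf => i; rewrite ler_pdivrMr//.
  have : t * x i - T x i = 1 := congr1 (fun u : ellinfty R => u i) tx.
  have : T (coord_inf x *: \1) i <= T x i.
    apply: positive_monotone => j; apply: le_trans (coord_inf_le x j).
    by rewrite -[in leRHS](mulr1 (coord_inf x)).
  rewrite linearZ => H; have {}H : coord_inf x * T \1 i <= T x i := H.
  have : T \1 i <= `|T \1|.
    by rewrite (le_trans (ler_norm _))// ellinfty_norm_ge.
  nra.
rewrite ler_pdivrMr// => H; nra.
Qed.

(** Otherwise the infimum of the entries of the solution at [t], a continuous
    function of [t], would go from a negative value at [s] to a nonnegative one
    at a large [b], and so would vanish somewhere in between, contradicting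
    [positive_resolvent_ge]. *)
Lemma positive_resolvent s : spectral_radius T < s ->
  exists2 x, s *: x - T x = \1 & coneK x.
Proof.
move=> rs.
have res t : spectral_radius T < t ->
  (forall w, exists x, t *: x - T x = w) /\
  (exists M, 0 <= M /\ forall x, `|x| <= M * `|t *: x - T x|).
  exact: (resolvent_of_gt_spectral_radius _ _ _ _ _
    (normr_ge0 (T \1)) positive_bounded).
have /choice[X XE] t : exists x, spectral_radius T < t -> t *: x - T x = \1.
  have [/res[/(_ \1)[x xE] _]|_] := ltP (spectral_radius T) t; first by exists x.
  by exists 0.
have X_cont t : spectral_radius T < t -> {for t, continuous (coord_inf \o X)}.
  move=> rt; have [_ [M [M0 TM]]] := res _ rt.
  apply: continuous_comp; first exact: resolvent_continuous XE rt M0 TM.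
  apply: (@lipschitz_continuous _ _ _ _ 1) => x y.
  by rewrite mul1r coord_inf_lipschitz.
exists (X s); first exact: XE.
suff Xs0 : 0 <= coord_inf (X s).
  by move=> i; exact: le_trans (coord_inf_le _ i).
rewrite leNgt; apply/negP => Xs_lt0.
pose b := Num.max s (`|T \1| + 1).
have sb : s <= b by rewrite le_max lexx.
have Xb0 : 0 <= coord_inf (X b).
  apply: (@coord_inf_resolvent_ge0 b); last exact/XE/(lt_le_trans rs).
  by rewrite (@lt_le_trans _ _ (`|T \1| + 1)) ?ltrDl// le_max lexx orbT.
have [||c cI Xc0] := @IVT R (coord_inf \o X) s b 0 sb.
- apply: continuous_in_subspaceT => t; rewrite inE/= in_itv/= => /andP[st _].
  exact/X_cont/(lt_le_trans rs).
- by rewrite ge_min le_max (ltW Xs_lt0) Xb0 orbT.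
have rc : spectral_radius T < c.
  by move: cI; rewrite in_itv/= => /andP[sc _]; exact: lt_le_trans sc.
have Xc : coneK (X c) by move=> i; rewrite -[leLHS]Xc0; exact: coord_inf_le.
have [c0 /le_coord_inf] := positive_resolvent_ge _ _ (XE _ rc) Xc.
by rewrite -[coord_inf _]/((coord_inf \o X) c) Xc0 leNgt invr_gt0 c0.
Qed.

End positive_operator.

(** * The gain operator of the network *)

Section gain_operator.
Context {R : realType}.
Variables (lambda : nat -> R) (gamma : nat -> nat -> R) (lambda_lo : R).
Hypothesis lambda_lo_gt0 : 0 < lambda_lo.
Hypothesis lambda_lo_le : forall i, lambda_lo <= lambda i.
Hypothesis gamma_ge0 : forall i j, 0 <= gamma i j.
Hypothesis gamma_sup :
  (ereal_sup (range (fun j => \sum_(i <oo) (gamma i j)%:E)) < +oo)%E.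
Variable Theta : ellinfty R -> ellinfty R.
Hypothesis ThetaE : forall x i,
  Theta x i = limn (series (fun j => gamma j i / lambda j * x j)).

Let lambda_gt0 i : 0 < lambda i.
Proof. exact: lt_le_trans (lambda_lo_le i). Qed.

Lemma gain_operator_cvg (x : ellinfty R) i :
  series (fun j => gamma j i / lambda j * x j) @ \oo --> Theta x i.
Proof.
have [G GP] :=
  gain_operator_exists lambda_lo_gt0 lambda_lo_le gamma_ge0 gamma_sup.
suff -> : Theta x i = G x i by exact: GP.
by rewrite ThetaE; apply: cvg_lim => //; exact: GP.
Qed.

Lemma gain_operator_linear : linear Theta.
Proof.
move=> a x y; apply/val_inj/funext => i.
have -> : val (a *: Theta x + Theta y) i = a * Theta x i + Theta y i by [].
rewrite [LHS]ThetaE; apply: cvg_lim => //.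
have -> : series (fun j => gamma j i / lambda j * (a *: x + y : ellinfty R) j)
    = (fun n => a * series (fun j => gamma j i / lambda j * x j) n
                + series (fun j => gamma j i / lambda j * y j) n).
  apply/funext => n; rewrite /series/= mulr_sumr -big_split/=.
  by apply: eq_bigr => j _; rewrite mulrDr [in LHS]mulrCA.
apply: cvgD; last exact: gain_operator_cvg.
by apply: cvgMr; exact: gain_operator_cvg.
Qed.

Lemma gain_operator_positive x : coneK x -> coneK (Theta x).
Proof.
move=> x0 i; rewrite ThetaE; apply: limr_ge.
  by apply/cvg_ex; exists (Theta x i); exact: gain_operator_cvg.
apply: nearW => n; apply: sumr_ge0 => j _.
by rewrite mulr_ge0// divr_ge0// ltW.
Qed.

(** Dividing [x] by [lambda] entrywise turns [Theta x <= s x] into the decay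
    estimate: row [i] of [mu^T (- Lambda + Gamma)] is [- x_i + (Theta x)_i], at
    most [- (1 - s) lambda_i mu_i].  The bound [L] keeps [mu] away from [0]. *)
Lemma decay_vector_of_gain_operator (L s : R) (x : ellinfty R) :
  (forall i, lambda i <= L) -> 0 < s -> s < 1 ->
  (forall i, s^-1 <= x i) -> (forall i, Theta x i <= s * x i) ->
  exists2 mu : ellinfty R, (@coneK R)° mu &
    forall i, row_mulLG lambda gamma mu i / mu i <= - ((1 - s) * lambda_lo).
Proof.
move=> lambdaL s0 s1 sx Tx.
have L0 : 0 < L by exact: lt_le_trans (lambdaL 0%N).
have x0 i : 0 < x i by apply: lt_le_trans (sx i); rewrite invr_gt0.
have mu_bounded : (fun i => x i / lambda i) \in @bounded_seq R.
  apply/bounded_seqP; exists (`|x| / lambda_lo) => i.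
  rewrite normrM normfV ler_pM ?invr_ge0//; first exact: ellinfty_norm_ge.
  by rewrite gtr0_norm// lef_pV2 ?posrE.
exists (Ellinfty mu_bounded) => [|i /=].
  rewrite interior_coneK; exists (s^-1 / L); first by rewrite divr_gt0 ?invr_gt0.
  by move=> i /=; rewrite ler_pM ?invr_ge0 ?(ltW s0) ?(ltW L0)// lef_pV2 ?posrE.
have -> : row_mulLG lambda gamma (Ellinfty mu_bounded) i = - x i + Theta x i.
  rewrite /row_mulLG/= mulNr mulrCA divff ?gt_eqF// mulr1 ThetaE.
  congr (_ + limn (series _)); apply/funext => j.
  by rewrite mulrC mulrA [RHS]mulrAC.
rewrite invf_div mulrA ler_pdivrMr//.
have : 0 <= lambda i * (s * x i - Theta x i).
  by rewrite mulr_ge0 ?subr_ge0// ltW.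
have : 0 <= (1 - s) * x i * (lambda i - lambda_lo).
  by rewrite !mulr_ge0 ?subr_ge0// ltW.
nra.
Qed.

End gain_operator.

Theorem lemmaV10 (R : realType)
    (I : nat -> set nat) (lambda : nat -> R) (gamma : nat -> nat -> R)
    (I_finite : forall i, finite_set (I i))
    (I_irr : forall i, ~ I i i)
    (lambda_gt0 : forall i, 0 < lambda i)
    (gamma_gt0 : forall i j, I i j -> 0 < gamma i j)
    (gamma_eq0 : forall i j, ~ I i j -> gamma i j = 0)
    (lambda_lo : R) (lambda_lo_gt0 : 0 < lambda_lo)
    (lambda_lo_le : forall i, lambda_lo <= lambda i)
    (gamma_sup : (ereal_sup (range (fun j => \sum_(i <oo) (gamma i j)%:E))
                    < +oo)%E)
    (lambda_ub : has_ubound (range lambda))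
    (Theta : ellinfty R -> ellinfty R)
    (ThetaE : forall x i,
      Theta x i = limn (series (fun j => gamma j i / lambda j * x j))) :
  spectral_radius Theta < 1 ->
  (exists (mu : ellinfty R) (lambda_oo : R),
     [/\ (@coneK R)° mu, 0 < lambda_oo
       & forall i, row_mulLG lambda gamma mu i / mu i <= - lambda_oo]) /\
  (forall rho : R, 0 < rho ->
     exists (mu : ellinfty R) (lambda_oo : R),
       [/\ (@coneK R)° mu, 0 < lambda_oo,
           forall i, row_mulLG lambda gamma mu i / mu i <= - lambda_oo
         & (1 - spectral_radius Theta) * lambda_lo - rho <= lambda_oo]).
Proof.
move=> r1.
have gamma_ge0 i j : 0 <= gamma i j.
  by have [/gamma_gt0/ltW//|/gamma_eq0->] := pselect (I i j).
have [L Lub] := lambda_ub.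
have lambdaL i : lambda i <= L by apply: Lub; exists i.
pose T : {linear ellinfty R -> ellinfty R} := HB.pack Theta
  (GRing.isLinear.Build _ _ _ _ _ (gain_operator_linear _ _ _
     lambda_lo_gt0 lambda_lo_le gamma_ge0 gamma_sup _ ThetaE)).
have T_pos x : coneK x -> coneK (T x).
  exact: (gain_operator_positive _ _ _
    lambda_lo_gt0 lambda_lo_le gamma_ge0 gamma_sup _ ThetaE).
have decay s : spectral_radius Theta < s -> s < 1 ->
    exists2 mu : ellinfty R, (@coneK R)° mu &
    forall i, row_mulLG lambda gamma mu i / mu i <= - ((1 - s) * lambda_lo).
  move=> rs s1; have [x Tx x0] := positive_resolvent T T_pos _ rs.
  have [s0 sx] := positive_resolvent_ge _ T_pos _ _ Tx x0.
  apply: (decay_vector_of_gain_operator _ _ _ lambda_lo_gt0 lambda_lo_le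
    _ ThetaE L s x) => // i.
  have : s * x i - Theta x i = 1 := congr1 (fun u : ellinfty R => u i) Tx.
  lra.
suff rate rho : 0 < rho -> exists (mu : ellinfty R) (lambda_oo : R),
    [/\ (@coneK R)° mu, 0 < lambda_oo,
        forall i, row_mulLG lambda gamma mu i / mu i <= - lambda_oo
      & (1 - spectral_radius Theta) * lambda_lo - rho <= lambda_oo].
  split=> //; have [mu [l [muK l0 mul _]]] := rate 1 ltr01.
  by exists mu, l.
move=> rho0; set r := spectral_radius Theta in r1 decay *.
(* A step below half the gap keeps [r + d < 1]; a step below
   [rho / lambda_lo] costs at most [rho] in the decay rate. *)
pose d := Num.min ((1 - r) / 2) (rho / lambda_lo).
have d0 : 0 < d by rewrite lt_min !divr_gt0// subr_gt0.
have d1 : d <= (1 - r) / 2 by rewrite ge_min lexx.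
have d2 : d * lambda_lo <= rho by rewrite -ler_pdivlMr// ge_min lexx orbT.
have [||mu muK mul] := decay (r + d); [lra|lra|].
exists mu, ((1 - (r + d)) * lambda_lo); split => //; last lra.
by rewrite mulr_gt0//; lra.
Qed.
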